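(* Let $X$ be a countably compact (Tychonoff) space. Then $X$ is monotonically retractable if and only if $X$ has a full retractional skeleton.
   Context: All topological spaces are assumed to be Tychonoff (completely regular Hausdorff). A retraction on $X$ is a continuous map $r:X\to X$ with $r\circ r=r$. Retractional skeleton: a retractional skeleton in a countably compact space $X$ is a family of continuous retractions $\mathfrak{s}=\{r_s\}_{s\in\Gamma}$ on $X$, indexed by an up-directed partially ordered set $\Gamma$, such that (i) $r_s[X]$ is a metrizable compact space for each $s\in\Gamma$; (ii) if $s,t\in\Gamma$ and $s\le t$ then $r_s=r_s\circ r_t=r_t\circ r_s$; (iii) given $s_0<s_1<\cdots$ in $\Gamma$, $t=\sup_{n\in\omega}s_n$ exists in $\Gamma$ and $r_t(x)=\lim_{n\to\infty}r_{s_n}(x)$ for every $x\in X$; (iv) for every $x\in X$, $x=\lim_{s\in\Gamma}r_s(x)$. The set induced by $\mathfrak{s}$ is $D(\mathfrak{s})=\bigcup_{s\in\Gamma}r_s[X]$. The skeleton $\mathfrak{s}$ is full if $D(\mathfrak{s})=X$. Monotonically retractable: a space $X$ is monotonically retractable if one can assign to every countable set $A\subset X$ a retraction $r_A:X\to X$ and a countable family $\mathcal{N}(A)$ of subsets of $X$ such that: $A\subset r_A[X]$; the assignment $A\mapsto\mathcal{N}(A)$ is $\omega$-monotone, i.e. $A\subset B$ (countable) implies $\mathcal{N}(A)\subset\mathcal{N}(B)$, and $\mathcal{N}(\bigcup_{n}A_n)=\bigcup_{n}\mathcal{N}(A_n)$ for every increasing sequence $(A_n)$ of countable subsets of $X$;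 and $\mathcal{N}(A)$ is a network of $r_A$, i.e. $r_A^{-1}(U)$ is the union of a subfamily of $\mathcal{N}(A)$ for every open $U\subset X$. *)

(* Defs.v *)
From HB Require Import structures.
From mathcomp Require Import all_boot all_order all_algebra.
From mathcomp Require Import all_classical all_reals all_analysis.

Set Implicit Arguments.
Unset Strict Implicit.
Unset Printing Implicit Defensive.

Import Order.TTheory.

Local Open Scope classical_set_scope.
Local Open Scope order_scope.

Definition tychonoff_space (T : topologicalType) : Prop :=
  completely_regular_space T /\ hausdorff_space T.

Definition countably_compact {T : topologicalType} (A : set T) : Prop :=
  forall (I : choiceType) (D : set I) (U : I -> set T),
    countable D -> (forall i, D i -> open (U i)) -> A `<=` cover D U ->
    finite_subset_cover D U A.

Definition homeomorphic (S T : topologicalType) : Prop :=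
  exists (f : S -> T) (g : T -> S),
    [/\ cancel f g, cancel g f, continuous f & continuous g].

Definition metrizable (R : realType) (T : topologicalType) : Prop :=
  exists M : metricType R, homeomorphic T M.

Definition retraction {T : topologicalType} (r : T -> T) : Prop :=
  continuous r /\ r \o r = r.

(* Directed sets are nonempty; this makes [eventually_in] a proper filter. *)
Definition up_directed d (G : porderType d) : Prop :=
  (exists s : G, True) /\ forall s t : G, exists u, s <= u /\ t <= u.

(* The filter of tails of G: convergence of a net indexed by G is convergence
   along this filter. *)
Definition eventually_in d (G : porderType d) : set_system G :=
  filter_from [set: G] (fun s0 => [set s | s0 <= s]).
Arguments eventually_in {d} G _.

(* [set_type A] carries the subspace topology on A. *)
Record retractional_skeleton (R : realType) (T : topologicalType)
    d (G : porderType d) (r : G -> T -> T) : Prop := {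
  rskel_directed : up_directed G ;
  rskel_retraction : forall s, retraction (r s) ;
  rskel_compact : forall s, compact (range (r s)) ;
  rskel_metrizable : forall s, metrizable R (set_type (range (r s))) ;
  rskel_compose : forall s t, s <= t -> r s = r s \o r t /\ r s = r t \o r s ;
  rskel_sup : forall s : nat -> G, (forall n, s n < s n.+1) ->
    exists t, isLub (range s) t /\
      forall x, r (s n) x @[n --> \oo] --> r t x ;
  rskel_lim : forall x, r s x @[s --> eventually_in G] --> x
}.

Definition induced_set (T : topologicalType) d (G : porderType d)
    (r : G -> T -> T) : set T :=
  \bigcup_s range (r s).

Definition has_full_retractional_skeleton (R : realType)
    (T : topologicalType) : Prop :=
  exists (d : Order.disp_t) (G : porderType d) (r : G -> T -> T),
    retractional_skeleton R r /\ induced_set r = [set: T].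

Definition network_of (S T : topologicalType) (N : set (set S)) (f : S -> T) :
    Prop :=
  forall U : set T, open U ->
    exists2 M : set (set S), M `<=` N & f @^-1` U = \bigcup_(B in M) B.

Definition omega_monotone (T : Type) (N : set T -> set (set T)) : Prop :=
  (forall A B, countable A -> countable B -> A `<=` B -> N A `<=` N B) /\
  (forall A : nat -> set T, (forall n, countable (A n)) ->
    (forall n, A n `<=` A n.+1) -> N (\bigcup_n A n) = \bigcup_n N (A n)).

(* The assignments are total functions on [set T]; their values at uncountable
   sets are irrelevant. *)
Definition monotonically_retractable (T : topologicalType) : Prop :=
  exists (r : set T -> T -> T) (N : set T -> set (set T)),
    (forall A, countable A ->
      [/\ retraction (r A), countable (N A), A `<=` range (r A)
        & network_of (N A) (r A)]) /\
    omega_monotone N.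

(* Main.v *)
Require Import Defs.
From HB Require Import structures.
From mathcomp Require Import all_boot all_order all_algebra.
From mathcomp Require Import all_classical all_reals all_analysis.
From mathcomp Require Import lra finmap.

Set Implicit Arguments.
Unset Strict Implicit.
Unset Printing Implicit Defensive.

Import Order.TTheory GRing.Theory Num.Theory.
Import numFieldNormedType.Exports.

Local Open Scope classical_set_scope.

(** Both properties describe a system of retractions onto compact metrizable
pieces of [X], indexed by countable sets on one side and by an abstract
directed poset on the other.

From a monotone assignment [A |-> (r_A, N(A))] to a skeleton.  A countable set
[A] is called rich when it meets [B `&` C] for all [B, C] in [N(A)] that meet.
Since [r_A] fixes [A] pointwise, richness transfers what happens at an arbitrary
point [x] to a point of [A] lying in the same network elements as [x].  This
gives three facts: [r_A[X]] is the closure of [A]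
([rich_range_closure]); [r_A \o r_B = r_A] for countable [A `<=` B] with [B]
rich ([rich_retraction_comp]), whence the two compatibility identities; and
[r_(A n) x] tends to [r_A x] along an increasing sequence of rich sets with
union [A] ([rich_chain_cvg]).  As [N] is omega-monotone, a closing-off
argument embeds every countable set in a rich one ([rich_hull]), and rich sets
are stable under increasing unions ([rich_bigcup]).  So the rich sets ordered
by inclusion index a full skeleton.  A range [r_A[X]] is compact because a
countable network reduces any open cover to a countable one, to which countable
compactness applies; it is metrizable because, by complete regularity, countably
many continuous functions, one for each separable pair of network elements,
separate its points.

From a full skeleton [(r_s)] to a monotone assignment.  Choose for every [x] an
index [e x] with [x] in the range of [r_(e x)], and a binary upper bound
operation on the indices.  For countable [A] let [C(A)] be the closure of
[e @` A] (and a base index) under this operation: it is countable, directed,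
and [A |-> C(A)] is omega-monotone.  The skeleton provides an index [t(A)]
above [C(A)] such that [r_t(A)] depends only on the [r_c], [c] in [C(A)]
([determining_boundP]).  Put [r_A := r_t(A)] and let [N(A)] consist of the
preimages under [r_c], [c] in [C(A)], of a countable base of the range of
[r_c].  This is a network of [r_A] by compactness of the range of [r_A], whose
points are separated by the maps [r_c] ([skeleton_networkP]). *)

(** * Countable sets *)

Lemma countable_enum (T : Type) (S : set T) (x0 : T) :
  countable S -> S x0 -> exists e : nat -> T, S = range e.
Proof.
move=> cS Sx0.
have : S !=set0 by exists x0.
move=> /set0P S0; case: (pfcard_geP cS) => [S00|[f]].
  by rewrite S00 eqxx in S0.
exists f; apply/seteqP; split => [x Sx|_ [n _ <-]]; last exact: funS.
by have [n _ <-] := @surj _ _ _ _ f x Sx; exists n.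
Qed.

Lemma countable_setU (T : Type) (A B : set T) :
  countable A -> countable B -> countable (A `|` B).
Proof.
move=> cA cB; rewrite -bigcup2E.
by apply: bigcup_countable => // -[|[|n]] _.
Qed.

Lemma countable_transversal (T : Type) (F : set (set T)) :
  countable F ->
  exists2 A, countable A & forall B, F B -> B !=set0 -> B `&` A !=set0.
Proof.
move=> cF; have [[x0 _]|nT] := pselect (exists x0 : T, True); last first.
  by exists set0 => // B _ [x _]; case: nT; exists x.
have [e eP] : {e : set T -> T & forall B, B !=set0 -> B (e B)}.
  apply: (@choice _ _ (fun B x => B !=set0 -> B x)) => B.
  have [[x Bx]|nB] := pselect (B !=set0); first by exists x.
  by exists x0 => /nB.
exists (e @` F) => [|B FB B0]; first exact: sub_countable (card_image_le _ _) cF.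
by exists (e B); split; [exact: eP|exists B].
Qed.

Lemma chain_le (T : Type) (A : nat -> set T) :
  (forall n, A n `<=` A n.+1) -> forall m n, (m <= n)%N -> A m `<=` A n.
Proof.
move=> Ai m n /subnKC <-; elim: (n - m)%N => [|k IH]; first by rewrite addn0.
by rewrite addnS; exact: subset_trans IH _.
Qed.

(** * Compactness *)

Lemma compact_set_type (X : topologicalType) (K : set X) :
  compact K -> compact [set: set_type K].
Proof.
move=> cK F PF _.
have FK : (fmap (set_val : K -> X) F) K.
  have E : (set_val : K -> X) @^-1` K = setT.
    by apply/seteqP; split => // y _; exact: set_valP.
  by rewrite /fmap /= E; exact: filterT.
have [x [Kx clx]] := cK _ _ FK.
exists (SigSub (mem_set Kx)); split => // A B FA [_ [[W oW <-] /= Wx] WB].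
have [||_ [[y Ay <-] Wy]] := clx (set_val @` A) W.
- have sA : A `<=` set_val @^-1` (set_val @` A) by move=> y Ay; exists y.
  exact: (filterS sA FA).
- exact: open_nbhs_nbhs.
by exists y; split => //; exact: WB.
Qed.

(** Extends [compact_cover] to spaces without a distinguished point: a space
without points is compact in both senses. *)
Lemma compact_coverE (T : topologicalType) (A : set T) :
  compact A <-> cover_compact A.
Proof.
have [[x0 _]|nT] := pselect (exists x0 : T, True).
  pose pT := HB.pack_for ptopologicalType T (isPointed.Build T x0).
  by rewrite -[@compact T]/(@compact pT) compact_cover.
have -> : A = set0 by rewrite -subset0 => x; case: nT; exists x.
split=> [_ I D f _ _|_]; last exact: compact0.
by exists fset0.
Qed.

Lemma metric_compact_second_countable (R : realType) (M : metricType R) :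
  compact [set: M] -> @second_countable M.
Proof.
have [[x0 _]|nM] := pselect (exists x0 : M, True).
  pose pM := HB.pack_for (pseudoPMetricType R) M (isPointed.Build M x0).
  exact: (@compact_second_countable R pM).
move=> _; exists set0; first exact: countable0.
by split => // x; case: nM; exists x.
Qed.

Lemma continuous_bij_homeomorphic (S T : topologicalType)
    (f : S -> T) (g : T -> S) :
  compact [set: S] -> hausdorff_space T -> cancel f g -> cancel g f ->
  continuous f -> homeomorphic S T.
Proof.
move=> cS hT fg gf cf; exists f, g; split => //.
apply/continuous_closedP => C clC.
have -> : g @^-1` C = f @` C.
  apply/seteqP; split => [y Cy|_ [x Cx <-]]; last by rewrite /preimage /= fg.
  by exists (g y).
apply: compact_closed => //; apply: continuous_compact.
  exact: continuous_subspaceT.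
by apply: subclosed_compact cS _ => //.
Qed.

(** * Metrizability of compact spaces *)

Section sup_metric.
Context {R : realType} {K : choiceType} (f : nat -> K -> R).
Local Open Scope ring_scope.

Definition sup_dist_terms (x y : K) : set R :=
  range (fun n => `|f n x - f n y| / n.+1%:R).

Definition sup_dist (x y : K) : R := sup (sup_dist_terms x y).

Hypothesis f01 : forall n x, 0 <= f n x <= 1.

Lemma sup_dist_term_le n x y : `|f n x - f n y| / n.+1%:R <= n.+1%:R^-1.
Proof.
rewrite ler_piMl ?invr_ge0// ler_norml.
have /andP[] := f01 n x; have /andP[] := f01 n y; lra.
Qed.

Lemma ge_sup_dist x y n : `|f n x - f n y| / n.+1%:R <= sup_dist x y.
Proof.
apply: ub_le_sup; last by exists n.
exists 1 => _ [m _ <-]; apply: (le_trans (sup_dist_term_le m x y)).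
by rewrite invf_le1// ler1n.
Qed.

Lemma le_sup_dist x y c :
  (forall n, `|f n x - f n y| / n.+1%:R <= c) -> sup_dist x y <= c.
Proof.
move=> le_c; apply: ge_sup.
  by eexists; exists 0%N.
by move=> _ [m _ <-].
Qed.

Lemma sup_dist_xx x : sup_dist x x = 0.
Proof.
apply/eqP; rewrite eq_le; apply/andP; split.
  by apply: le_sup_dist => n; rewrite subrr normr0 mul0r.
by apply: (le_trans _ (ge_sup_dist x x 0%N)); rewrite divr_ge0.
Qed.

Lemma sup_dist_sym x y : sup_dist x y = sup_dist y x.
Proof.
by rewrite /sup_dist; congr sup; apply: eq_imagel => n _; rewrite distrC.
Qed.

Lemma sup_dist_triangle y x z :
  sup_dist x z <= sup_dist x y + sup_dist y z.
Proof.
apply: le_sup_dist => n.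
apply: (le_trans _ (lerD (ge_sup_dist x y n) (ge_sup_dist y z n))).
by rewrite -mulrDl ler_pM2r ?invr_gt0//; exact: ler_distD.
Qed.

Hypothesis f_sep : forall x y, (forall n, f n x = f n y) -> x = y.

Lemma sup_dist_positivity x y : sup_dist x y = 0 -> x = y.
Proof.
move=> xy0; apply: f_sep => n; apply/eqP; rewrite -subr_eq0 -normr_le0.
have := ge_sup_dist x y n; rewrite xy0.
by rewrite pmulr_lle0// invr_gt0.
Qed.

(** A copy of [K], so that the metric topology does not compete with a topology
that [K] already carries; the two hypotheses on [f] are arguments because they
are what makes [sup_dist] a distance. *)
Definition sup_metric of (forall n x, 0 <= f n x <= 1) &
  (forall x y, (forall n, f n x = f n y) -> x = y) : Type := K.

HB.instance Definition _ := Choice.on (sup_metric f01 f_sep).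
HB.instance Definition _ := isMetric.Build R (sup_metric f01 f_sep)
  sup_dist_xx sup_dist_positivity sup_dist_sym sup_dist_triangle.

End sup_metric.

Section sup_metric_topology.
Local Open Scope ring_scope.

(** The weights [1 / n.+1] make all but finitely many coordinates uniformly
small, and each of the remaining ones is continuous. *)
Lemma sup_metric_continuous (R : realType) (K : topologicalType)
    (f : nat -> K -> R) (f01 : forall n x, 0 <= f n x <= 1)
    (f_sep : forall x y, (forall n, f n x = f n y) -> x = y) :
  (forall n, continuous (f n)) -> continuous (id : K -> sup_metric f01 f_sep).
Proof.
move=> cf x U; rewrite nbhs_ballP => -[e /= e0 eU].
have [N _ Ne] :
    exists2 N : nat, True & forall n, (N < n)%N -> n.+1%:R^-1 <= e / 2.
  have [//|N] := @ltr_add_invr R 0 (e / 2) _; first by rewrite divr_gt0.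
  rewrite add0r => Ne; exists N => // n Nn; apply/ltW/le_lt_trans/Ne.
  by rewrite lef_pV2 ?posrE// ler_nat; exact: ltnW.
have near_lt n : \forall y \near x, `|f n x - f n y| < e / 2.
  by have /cvgrPdist_lt := cf n x; apply; rewrite divr_gt0.
have near_all :
    \forall y \near x, forall n, (n < N.+1)%N -> `|f n x - f n y| < e / 2.
  have := @filter_forall _ _
    (fun i : 'I_N.+1 => [set y | `|f i x - f i y| < e / 2]) (nbhs x)
    (nbhs_filter x) (fun i => near_lt i).
  apply: filterS => y yP n nN.
  exact: (yP (Ordinal nN)).
apply: filterS near_all => y yP; apply: eU; rewrite ballEmdist /=.
apply: (@le_lt_trans _ _ (e / 2)); last by lra.
apply: le_sup_dist => n; have [nN|Nn] := ltnP n N.+1.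
  apply/ltW/le_lt_trans/(yP n nN).
  by rewrite ler_piMr// invf_le1// ler1n.
exact/(le_trans (sup_dist_term_le f01 n x y))/Ne.
Qed.

End sup_metric_topology.

(** The identity from the given compact topology to the metric one defined by
the countable family is a continuous bijection onto a Hausdorff space. *)
Lemma compact_separated_metrizable (R : realType) (K : topologicalType)
    (F : set (K -> R)) :
  compact [set: K] -> countable F ->
  (forall h, F h -> continuous h /\ forall x, (0 <= h x <= 1)%R) ->
  (forall x y, (forall h, F h -> h x = h y) -> x = y) ->
  metrizable R K.
Proof.
move=> cK cF F01 F_sep.
(* The constant function makes the family nonempty, hence a sequence. *)
pose F' := F `|` [set (fun=> 0%R : R)].
have F'01 h : F' h -> continuous h /\ forall x, (0 <= h x <= 1)%R.
  by case=> [/F01//|->]; split => [|x]; [exact: cst_continuous|rewrite lexx ler01].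
have [||f F'f] := @countable_enum _ F' (fun=> 0%R : R).
- exact: countable_setU cF (countable1 _).
- by right.
have ff n : F' (f n) by rewrite F'f; exists n.
have f01 n x : (0 <= f n x <= 1)%R by have [_] := F'01 _ (ff n).
have f_sep x y : (forall n, f n x = f n y) -> x = y.
  move=> fxy; apply: F_sep => h Fh.
  have : F' h by left.
  by rewrite F'f => -[n _ <-].
exists (sup_metric f01 f_sep).
refine (@continuous_bij_homeomorphic K (sup_metric f01 f_sep)
  id id cK _ _ _ _) => //.
  exact: metric_hausdorff.
by apply: sup_metric_continuous => n; have [] := F'01 _ (ff n).
Qed.

Lemma metrizable_countable_base (R : realType) (X : topologicalType)
    (K : set X) :
  compact K -> metrizable R (set_type K) ->
  exists2 B : set (set X), countable B & forall O x, open O -> O x -> K x ->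
    exists b, [/\ B b, b x & b `&` K `<=` O].
Proof.
move=> cK [M [f [g [fg gf cf cg]]]].
have cM : compact [set: M].
  have -> : [set: M] = f @` [set: set_type K].
    by apply/seteqP; split => // y _; exists (g y).
  apply: continuous_compact (compact_set_type cK).
  exact: continuous_subspaceT.
have [C cC [_ baseC]] := metric_compact_second_countable cM.
exists [set [set \val (g y) | y in c] | c in C].
  exact: sub_countable (card_image_le _ _) cC.
move=> O x oO Ox Kx; pose x' : set_type K := SigSub (mem_set Kx).
have oO' : open ((set_val \o g) @^-1` O).
  apply: open_comp oO => y _; apply: continuous_comp; first exact: cg.
  exact: initial_continuous.
have O'x : ((set_val \o g) @^-1` O) (f x') by rewrite /= fg.
have [c [Cc cx] cO] := baseC (f x') _ (open_nbhs_nbhs (conj oO' O'x)).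
exists [set \val (g y) | y in c]; split; first by exists c.
  by exists (f x') => //; rewrite fg.
by move=> _ [[y cy <-] _]; exact: cO.
Qed.

(** * Retractions with a countable network *)

Lemma network_ofP (S T : topologicalType) (N : set (set S)) (f : S -> T) :
  network_of N f <-> forall U x, open U -> U (f x) ->
    exists B, [/\ N B, B x & B `<=` f @^-1` U].
Proof.
split=> [netN U x oU Ux|netN U oU].
  have [M MN fU] := netN U oU.
  have : (f @^-1` U) x by [].
  rewrite fU => -[B MB Bx]; exists B; split => //; first exact: MN.
  by move=> y By; exists B.
exists [set B | N B /\ B `<=` f @^-1` U] => [B []//|].
apply/seteqP; split => [x Ux|x [B [_ BU] /BU]//].
by have [B [NB Bx BU]] := netN U x oU Ux; exists B.
Qed.

Lemma retraction_fix (T : topologicalType) (r : T -> T) x :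
  retraction r -> range r x -> r x = x.
Proof. by case=> _ rr [y _ <-]; exact: (congr1 (fun f => f y) rr). Qed.

(** An open cover of the range needs only one member for each network element
whose image lies in some member; this countable subcover pulls back to a
countable open cover of the whole space. *)
Lemma compact_range_network (X : topologicalType) (r : X -> X)
    (N : set (set X)) :
  countably_compact [set: X] -> continuous r -> countable N ->
  network_of N r -> compact (range r).
Proof.
move=> ccX cr cN /network_ofP netN; apply/compact_coverE => I D f fo fcov.
pose good (B : set X) i := D i /\ B `<=` r @^-1` f i.
have [c cP] : {c : set X -> option I & forall B,
    if c B is Some i then good B i else forall i, ~ good B i}.
  apply: (@choice _ _ (fun B o =>
    if o is Some i then good B i else forall i, ~ good B i)) => B.
  have [[i Bi]|nB] := pselect (exists i, good B i); first by exists (Some i).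
  by exists None => i Bi; apply: nB; exists i.
pose D' := [set i | exists2 B, N B & c B = Some i].
have D'D : D' `<=` D by move=> i [B _ Bi]; have := cP B; rewrite Bi => -[].
have cD' : countable D'.
  have [e eP] : {e : I -> set X & forall i, D' i -> N (e i) /\ c (e i) = Some i}.
    apply: (@choice _ _ (fun i B => D' i -> N B /\ c B = Some i)) => i.
    have [[B NB Bi]|nD] := pselect (D' i); first by exists B.
    by exists set0 => /nD.
  have /countable_injP[h hP] := cN.
  apply/countable_injP; exists (h \o e) => i j.
  move=> /set_mem /eP[Ni ci] /set_mem /eP[Nj cj] /=.
  move=> /(hP _ _ (mem_set Ni) (mem_set Nj)) eij.
  by move: ci; rewrite eij cj => -[].
have [] := ccX I D' (fun i => r @^-1` f i) cD'.
- by move=> i /D'D Di; apply: open_comp => [x _|]; [exact: cr|exact: fo].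
- move=> x _; have [|i Di fix_] := fcov (r x); first by exists x.
  have [B [NB Bx Bi]] := netN _ _ (fo _ Di) fix_.
  have := cP B; case E : (c B) => [j|] => [[Dj Bj]|/(_ i)]; last by case.
  by exists j; [exists B|exact: Bj].
move=> D0 D0D' cov; exists D0; first by move=> i /D0D'/set_mem/D'D/mem_set.
by move=> _ [x _ <-]; have [//|i Di fi] := cov x; exists i.
Qed.

(** For each pair of network elements whose images some continuous function
with values in the unit interval puts on opposite sides of [1/2], keep one such
function.  Any two points of the range lie in such a pair, by complete
regularity. *)
Lemma network_metrizable (R : realType) (X : topologicalType) (r : X -> X)
    (N : set (set X)) :
  tychonoff_space X -> retraction r -> countable N -> network_of N r ->
  compact (range r) -> metrizable R (set_type (range r)).
Proof.
move=> [crX hX] rr cN /network_ofP netN cK.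
pose sep (B : set X * set X) (h : X -> R) :=
  [/\ continuous h, forall x, (0 <= h x <= 1)%R,
    (forall x, B.1 x -> (h (r x) < 2^-1)%R) &
    (forall x, B.2 x -> (2^-1 < h (r x))%R)].
pose cont01 (h : X -> R) := continuous h /\ forall x, (0 <= h x <= 1)%R.
have [c cP] : {c : set X * set X -> X -> R & forall B,
    cont01 (c B) /\ ((exists h, sep B h) -> sep B (c B))}.
  apply: (@choice _ _ (fun B h =>
    cont01 h /\ ((exists h, sep B h) -> sep B h))) => B.
  have [[h Bh]|nB] := pselect (exists h, sep B h).
    by exists h; split => //; case: Bh.
  exists (fun=> 0%R); split => // .
  by split => [|x]; [exact: cst_continuous|rewrite lexx ler01].
apply: (@compact_separated_metrizable _ _
  [set c B \o set_val | B in N `*` N]).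
- exact: compact_set_type.
- by apply: (sub_countable (card_image_le _ _)); exact: countableX.
- move=> _ [B _ <-]; have [[cB B01] _] := cP B; split => [x|x]; last exact: B01.
  by apply: continuous_comp; [exact: initial_continuous|exact: cB].
move=> x y xy; apply: contrapT => xNy.
have rx : r (\val x) = \val x by apply: retraction_fix rr (set_valP x).
have ry : r (\val y) = \val y by apply: retraction_fix rr (set_valP y).
have : uniform_separator [set \val x] [set \val y].
  apply: crX; first exact/accessible_closed_set1/hausdorff_accessible.
  by move=> /= /val_inj.
move=> /(@uniform_separatorP _ R)[h [ch h01 hx hy]].
have {}hx : h (\val x) = 0%R by apply: hx; exists (\val x).
have {}hy : h (\val y) = 1%R by apply: hy; exists (\val y).
have [||B1 [NB1 B1x B1h]] :=
    netN (h @^-1` [set t | (t < 2^-1)%R]) (\val x).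
- by apply: open_comp => [? _|]; [exact: ch|exact: open_lt].
- by rewrite /= rx hx invr_gt0.
have [||B2 [NB2 B2y B2h]] :=
    netN (h @^-1` [set t | (2^-1 < t)%R]) (\val y).
- by apply: open_comp => [? _|]; [exact: ch|exact: open_gt].
- by rewrite /= ry hy; lra.
have sB : exists h, sep (B1, B2) h.
  exists h; split => //= z; have /h01 /= : range h (h z) by exists z.
  by rewrite in_itv.
have [_ /(_ sB)[_ _ /(_ _ B1x) /= cx /(_ _ B2y) /= cy]] := cP (B1, B2).
have /= := xy (c (B1, B2) \o set_val)
  (ex_intro2 _ _ (B1, B2) (conj NB1 NB2) erefl).
move=> cxy; move: cx cy; rewrite rx ry.
move: cxy; rewrite !set_valE /=; lra.
Qed.

(** * Rich sets *)

(** The sets closed under picking a point in each nonempty intersection of two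
elements of their own network: a substitute for countable elementary
submodels. *)
Definition rich (T : Type) (N : set T -> set (set T)) (A : set T) :=
  countable A /\ forall B C, N A B -> N A C -> B `&` C !=set0 ->
    B `&` C `&` A !=set0.

Section rich_sets.
Context {T : Type} (N : set T -> set (set T)).
Hypothesis monoN : omega_monotone N.

Lemma omega_monotone_chain (A : nat -> set T) :
  (forall n, countable (A n)) -> (forall n, A n `<=` A n.+1) ->
  forall B C, N (\bigcup_n A n) B -> N (\bigcup_n A n) C ->
  exists n, N (A n) B /\ N (A n) C.
Proof.
move=> cA Ai B C; rewrite monoN.2// => -[m _ mB] [n _ nC].
exists (maxn m n); split.
  exact: (monoN.1 _ _ (cA m) (cA _) (chain_le Ai (leq_maxl _ _))).
exact: (monoN.1 _ _ (cA n) (cA _) (chain_le Ai (leq_maxr _ _))).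
Qed.

Lemma rich_bigcup (A : nat -> set T) :
  (forall n, rich N (A n)) -> (forall n, A n `<=` A n.+1) ->
  rich N (\bigcup_n A n).
Proof.
move=> rA Ai; split; first by apply: bigcup_countable => // n _; case: (rA n).
move=> B C NB NC BC.
have [|n [nB nC]] := omega_monotone_chain _ Ai NB NC.
  by move=> n; case: (rA n).
have [_ /(_ B C nB nC BC) [x [BCx Ax]]] := rA n.
by exists x; split => //; exists n.
Qed.

Hypothesis countN : forall A, countable A -> countable (N A).

(** Iterate the addition of a transversal of the pairwise intersections of the
current network; a pair of elements of the final network already occurs at a
finite stage. *)
Lemma rich_hull (A : set T) : countable A -> exists2 B, rich N B & A `<=` B.
Proof.
move=> cA.
have [F FP] : {F : set T -> set T & forall A, countable A ->
    [/\ countable (F A), A `<=` F A & forall B C, N A B -> N A C ->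
      B `&` C !=set0 -> B `&` C `&` F A !=set0]}.
  apply: (@choice _ _ (fun A A' => countable A ->
    [/\ countable A', A `<=` A' & forall B C, N A B -> N A C ->
      B `&` C !=set0 -> B `&` C `&` A' !=set0])) => D.
  have [cD|] := pselect (countable D); last by exists set0.
  have [|E cE EP] :=
      @countable_transversal _ [set P.1 `&` P.2 | P in N D `*` N D].
    apply: sub_countable (card_image_le _ _) _.
    by apply: countableX; exact: countN.
  exists (D `|` E) => _; split.
  - exact: countable_setU.
  - by move=> x; left.
  - move=> B C NB NC /(EP (B `&` C)) [|x [BCx Ex]]; first by exists (B, C).
    by exists x; split => //; right.
pose S n := iter n F A.
have cS n : countable (S n) by elim: n => //= n /FP[].
have Si n : S n `<=` S n.+1 by have [] := FP _ (cS n).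
exists (\bigcup_n S n); last by move=> x Ax; exists 0%N.
split; first exact: bigcup_countable.
move=> B C NB NC BC; have [n [nB nC]] := omega_monotone_chain cS Si NB NC.
have [_ _ /(_ B C nB nC BC) [x [BCx Sx]]] := FP _ (cS n).
by exists x; split => //; exists n.+1.
Qed.

End rich_sets.

Section rich_retractions.
Context {X : topologicalType} (r : set X -> X -> X) (N : set X -> set (set X)).
Hypothesis hX : hausdorff_space X.
Hypothesis rN : forall A, countable A ->
  [/\ retraction (r A), countable (N A), A `<=` range (r A)
    & network_of (N A) (r A)].
Hypothesis monoN : omega_monotone N.

Let r_fix A a : countable A -> A a -> r A a = a.
Proof. by move=> /rN[rA _ sA _] /sA; exact: retraction_fix. Qed.

Let r_net A U x : countable A -> open U -> U (r A x) ->
  exists B, [/\ N A B, B x & B `<=` r A @^-1` U].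
Proof. by move=> /rN[_ _ _ /network_ofP]; exact. Qed.

(** If [V] is an open neighborhood of [r A x], some network element [B] contains
[x] and is mapped into [V]; a point of [A] in [B] is fixed, hence lies in
[V]. *)
Lemma rich_range_closure A : rich N A -> range (r A) `<=` closure A.
Proof.
move=> [cA rA] _ [x _ <-] U /=; rewrite nbhsE => -[V [oV Vx] VU].
have [B [NB Bx BV]] := r_net cA oV Vx.
have [|a [[Ba _] Aa]] := rA B B NB NB; first by exists x.
by exists a; split => //; apply: VU; rewrite -(r_fix cA Aa); exact: BV.
Qed.

(** If the two sides differ at [x], separate them by disjoint open [U] and [V].
Network elements of [B] around [x] witness both [r A (r B x)] in [U] and
[r A x] in [V]; a point of [B] in both is fixed by [r B], so that [r A] would
send it to [U] and to [V]. *)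
Lemma rich_retraction_comp A B : countable A -> rich N B -> A `<=` B ->
  r A \o r B = r A.
Proof.
move=> cA [cB rB] AB; apply/funext => x /=; apply: contrapT => /eqP.
move: hX; rewrite open_hausdorff => /[apply].
move=> -[[U V] /= [/set_mem Ux /set_mem Vx] [oU oV UV]].
have [[crA _] _ _ _] := rN cA.
have oU' : open (r A @^-1` U) by apply: open_comp => // ? _; exact: crA.
have [P [NP Px PU]] := r_net cB oU' Ux.
have [Q [NQ Qx QV]] := r_net cA oV Vx.
have [||y [[Py Qy] By]] := rB P Q NP; first exact: (monoN.1 _ _ cA cB AB).
  by exists x.
have : (U `&` V) (r A y).
  by split; [have := PU _ Py; rewrite /= (r_fix cB By)|exact: QV].
by move/eqP : UV => ->.
Qed.

(** Every neighborhood of [r B x] is witnessed by a network element [Q] of [B]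
around [x]; a point of [B] in both [P] and [Q] is fixed by [r A] and [r B],
hence lies in [U] and in that neighborhood. *)
Lemma rich_closure A B U x P : rich N B -> B `<=` A -> countable A ->
  N B P -> P x -> P `<=` r A @^-1` U -> closure U (r B x).
Proof.
move=> [cB rB] BA cA NP Px PU V; rewrite nbhsE => -[W [oW Wx] WV].
have [Q [NQ Qx QW]] := r_net cB oW Wx.
have [|y [[Py Qy] By]] := rB P Q NP NQ; first by exists x.
exists y; split.
  by rewrite -(r_fix cA (BA _ By)); exact: PU.
by apply: WV; rewrite -(r_fix cB By); exact: QW.
Qed.

(** The network element witnessing that the limit has a given neighborhood
already belongs to [N (A n)] for all large [n]; regularity absorbs the closure
in [rich_closure]. *)
Lemma rich_chain_cvg (A : nat -> set X) x : regular_space X ->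
  (forall n, rich N (A n)) -> (forall n, A n `<=` A n.+1) ->
  r (A n) x @[n --> \oo] --> r (\bigcup_n A n) x.
Proof.
move=> regX rA Ai U /regX[V /= + VU]; rewrite nbhsE => -[W [oW Wx] WV].
have cA n : countable (A n) by case: (rA n).
have cU : countable (\bigcup_n A n) by exact: bigcup_countable.
have [P [NP Px PW]] := r_net cU oW Wx.
have [n [nP _]] := omega_monotone_chain monoN cA Ai NP NP.
exists n => // m /= nm; apply: VU; apply: (closureS WV).
have nP' := monoN.1 _ _ (cA n) (cA m) (chain_le Ai nm) _ nP.
apply: (rich_closure (rA m) _ cU nP' Px PW).
by move=> y Ay; exists m.
Qed.

End rich_retractions.

(** * From monotone retractability to a skeleton *)

Definition subfamily (T : Type) (P : set (set T)) := {A : set T | `[< P A >]}.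

HB.instance Definition _ T P := SubChoice.on (@subfamily T P).
HB.instance Definition _ T P :=
  [SubChoice_isSubPOrder of @subfamily T P by <: with set_display].

Lemma subfamily_leP (T : Type) (P : set (set T)) (A B : subfamily P) :
  (A <= B)%O <-> \val A `<=` \val B.
Proof. by rewrite leEsub subsetEset. Qed.

Lemma subfamilyP (T : Type) (P : set (set T)) (A : subfamily P) : P (\val A).
Proof. exact/asboolP/(valP A). Qed.

Lemma monotonically_retractable_full_skeleton (R : realType)
    (X : topologicalType) :
  tychonoff_space X -> countably_compact [set: X] ->
  monotonically_retractable X -> has_full_retractional_skeleton R X.
Proof.
move=> tX ccX [r [N [rN monoN]]]; have [crX hX] := tX.
have regX : regular_space X by exact: (@completely_regular_regular R).
have countN A : countable A -> countable (N A) by case/rN.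
have hull := rich_hull monoN countN.
have cK A : countable A -> compact (range (r A)).
  move=> cA; have [[cr _] cN _ net] := rN _ cA.
  exact: compact_range_network ccX cr cN net.
pose G := subfamily (rich N).
have richG (A : G) : rich N (\val A) by exact: subfamilyP.
have countG (A : G) : countable (\val A) by case: (richG A).
pose toG A (rA : rich N A) : G := exist _ A (asboolT rA).
exists set_display, G, (fun A => r (\val A)); split; last first.
  apply/seteqP; split => // x _; have [A rA Ax] := hull [set x] (countable1 x).
  exists (toG A rA) => //=.
  by have [_ _ sA _] := rN _ (proj1 rA); apply: sA; exact: Ax.
split.
- split; first by have [A rA _] := hull set0 (countable0 _); exists (toG A rA).
  move=> A B; have [|C rC ABC] := hull (\val A `|` \val B).
    exact: countable_setU (countG A) (countG B).
  exists (toG C rC).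
  by split; apply/subfamily_leP => x ?; apply: ABC; [left|right].
- by move=> A; have [] := rN _ (countG A).
- by move=> A; exact: cK.
- move=> A; have [rA cN _ net] := rN _ (countG A).
  exact: network_metrizable tX rA cN net (cK _ (countG A)).
- move=> A B /subfamily_leP AB; split.
    by rewrite (rich_retraction_comp hX rN monoN (countG A) (richG B)).
  (* The range of r B is closed and contains A, so it contains that of r A. *)
  have [rB _ sB _] := rN _ (countG B).
  apply/funext => x /=; rewrite (retraction_fix rB)//.
  apply: (compact_closed hX (cK _ (countG B))).
  apply: (closureS (subset_trans AB sB)).
  by apply: (rich_range_closure rN (richG A)); exists x.
- move=> A Alt.
  have Ai n : \val (A n) `<=` \val (A n.+1) by apply/subfamily_leP/ltW/Alt.
  pose AA := toG _ (rich_bigcup monoN (fun n => richG (A n)) Ai).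
  exists AA; split; last first.
    by move=> x; apply: (rich_chain_cvg rN monoN).
  split; first by move=> _ [n _ <-]; apply/subfamily_leP => x Ax; exists n.
  move=> B ubB; apply/subfamily_leP => x [n _ Ax].
  by have /subfamily_leP := ubB (A n) (ex_intro2 _ _ n I erefl); exact.
- (* The net is constant from any rich set containing x on. *)
  move=> x; have [A rA Ax] := hull [set x] (countable1 x).
  move=> U Ux; exists (toG A rA) => // B /= /subfamily_leP AB.
  have [rB _ sB _] := rN _ (countG B).
  by rewrite /= (retraction_fix rB); [exact: nbhs_singleton|apply/sB/AB/Ax].
Qed.

(** * Closure under a binary operation *)

Section op_hull.
Context {T : Type} (op : T -> T -> T).

Fixpoint op_level (S : set T) n : set T :=
  if n is m.+1
  then op_level S m `|` [set op x y | x in op_level S m & y in op_level S m]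
  else S.

Definition op_hull S := \bigcup_n op_level S n.

Lemma sub_op_hull S : S `<=` op_hull S.
Proof. by move=> x Sx; exists 0%N. Qed.

Lemma op_level_leq S m n : (m <= n)%N -> op_level S m `<=` op_level S n.
Proof. by apply: chain_le => k x; left. Qed.

Lemma op_hull_op S x y : op_hull S x -> op_hull S y -> op_hull S (op x y).
Proof.
move=> [m _ mx] [n _ ny]; exists (maxn m n).+1 => //=; right.
exists x; first exact: op_level_leq (leq_maxl _ _) _ mx.
by exists y => //; exact: op_level_leq (leq_maxr _ _) _ ny.
Qed.

Lemma countable_op_hull S : countable S -> countable (op_hull S).
Proof.
move=> cS; apply: bigcup_countable => // n _; elim: n => //= n IH.
apply: countable_setU => //.
rewrite image2E; apply: sub_countable (card_image_le _ _) _.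
exact: countableX.
Qed.

Lemma op_hullS S S' : S `<=` S' -> op_hull S `<=` op_hull S'.
Proof.
move=> SS x [n _ nx]; exists n => //.
elim: n x nx => [|n IH] x; first exact: SS.
case=> [/IH|[y /IH y' [z /IH z' <-]]]; first by left.
by right; exists y => //; exists z.
Qed.

Lemma op_hull_bigcup (S : nat -> set T) : (forall n, S n `<=` S n.+1) ->
  op_hull (\bigcup_n S n) = \bigcup_n op_hull (S n).
Proof.
move=> Si; apply/seteqP; split => [x [k _]|x [n _]]; last first.
  by apply: op_hullS => y Sy; exists n.
elim: k x => [|k IH] x /=.
  by move=> [n _ Sx]; exists n => //; exact: sub_op_hull.
case=> [/IH//|[y /IH [m _ my] [z /IH [n _ nz] <-]]].
exists (maxn m n) => //; apply: op_hull_op.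
  exact: op_hullS (chain_le Si (leq_maxl _ _)) _ my.
exact: op_hullS (chain_le Si (leq_maxr _ _)) _ nz.
Qed.

End op_hull.

(** * From a full skeleton to monotone retractability *)

Section skeleton.
Context {R : realType} {X : topologicalType}.
Context {d : Order.disp_t} {G : porderType d}.
Variable r : G -> X -> X.
Hypothesis hX : hausdorff_space X.
Hypothesis skel : retractional_skeleton R r.

Let skel_le_l s t x : (s <= t)%O -> r s (r t x) = r s x.
Proof. by case/(rskel_compose skel) => rs _; rewrite [in RHS]rs. Qed.

Let skel_le_r s t x : (s <= t)%O -> r t (r s x) = r s x.
Proof. by case/(rskel_compose skel) => _ rs; rewrite [in RHS]rs. Qed.

Lemma skeleton_range_le s t : (s <= t)%O -> range (r s) `<=` range (r t).
Proof. by move=> st _ [x _ <-]; exists (r s x) => //; exact: skel_le_r. Qed.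

(** What is needed of a supremum of [C]; it makes the case where [C] has a
greatest element uniform with the case of a strictly increasing cofinal
sequence. *)
Definition determining_bound (C : set G) t :=
  (forall c, C c -> (c <= t)%O) /\
  forall x y, (forall c, C c -> r c x = r c y) -> r t x = r t y.

(** A greatest element of [C] will do.  Otherwise [C] contains a strictly
increasing cofinal sequence, and the retraction at its supremum is a pointwise
limit of retractions indexed by [C]. *)
Lemma determining_boundP (C : set G) c0 : countable C -> C c0 ->
  (forall a b, C a -> C b -> exists c, [/\ C c, a <= c & b <= c]%O) ->
  exists t, determining_bound C t.
Proof.
move=> cC Cc0 dirC.
have [[m Cm maxm]|nomax] :=
    pselect (exists2 m, C m & forall c, C c -> (c <= m)%O).
  by exists m; split => // x y; exact.
have [e Ce] := countable_enum cC Cc0.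
have Cen n : C (e n) by rewrite Ce; exists n.
have [F FP] : {F : nat * G -> G & forall p, C p.2 ->
    [/\ C (F p), (e p.1 <= F p)%O & (p.2 < F p)%O]}.
  apply: (@choice _ _ (fun p c =>
    C p.2 -> [/\ C c, (e p.1 <= c)%O & (p.2 < c)%O])).
  move=> [n a] /=; have [Ca|] := pselect (C a); last by exists a.
  have [b Cb ba] : exists2 b, C b & ~ (b <= a)%O.
    apply: contrapT => nb; apply: nomax; exists a => // c Cc.
    by apply: contrapT => nca; apply: nb; exists c.
  have [c [Cc ac bc]] := dirC _ _ Ca Cb.
  have [u [Cu cu eu]] := dirC _ _ Cc (Cen n).
  exists u => _; split => //; apply: (lt_le_trans _ cu).
  rewrite lt_neqAle ac andbT.
  by apply/eqP => ac'; apply: ba; rewrite ac'.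
pose s := fix s n := if n is m.+1 then F (m, s m) else c0.
have Cs n : C (s n) by elim: n => //= n IH; have [] := FP (n, s n) IH.
have slt n : (s n < s n.+1)%O by have [] := FP (n, s n) (Cs n).
have es n : (e n <= s n.+1)%O by have [] := FP (n, s n) (Cs n).
have [t [[ub _] lim]] := rskel_sup skel slt.
exists t; split => [c|x y xy].
  rewrite Ce => -[n _ <-]; apply: le_trans (es n) _; apply: ub.
  by exists n.+1.
have Ex : (fun n => r (s n) x) = (fun n => r (s n) y).
  by apply/funext => n; exact: xy.
have := lim x; rewrite Ex => lx.
exact: (cvg_unique hX lx (lim y)).
Qed.

Definition skeleton_network (B : G -> set (set X)) (C : set G) : set (set X) :=
  \bigcup_(c in C) [set r c @^-1` b | b in B c].

(** Let [U] be an open neighborhood of [r t x].  A point [y] of the compact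
set [K = range (r t) `\` U] is separated from [x] by some [r c], [c] in [C].
Finitely many such separations cover [K]; their indices have a common bound [c]
in [C], and the intersection [O] of the corresponding neighborhoods of [x]
satisfies [O = r c @^-1` O] and meets no point of [K].  So a base element for
[r c x] in [O] pulls back to the required network element. *)
Lemma skeleton_networkP (B : G -> set (set X)) (C : set G) c0 t : C c0 ->
  (forall a b, C a -> C b -> exists c, [/\ C c, a <= c & b <= c]%O) ->
  (forall s O x, open O -> O x -> range (r s) x ->
    exists b, [/\ B s b, b x & b `&` range (r s) `<=` O]) ->
  determining_bound C t ->
  network_of (skeleton_network B C) (r t).
Proof.
move=> Cc0 dirC baseB [ub sep]; apply/network_ofP => U x oU Ux.
pose K := range (r t) `&` ~` U.
have cK : compact K.
  by apply: compact_closedI; [exact: (rskel_compact skel)|exact: open_closedC].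
have sepC y : K y -> exists (VW : set X * set X) c,
    [/\ C c, open VW.1, open VW.2, VW.1 (r c x) & VW.2 (r c y)] /\
    VW.1 `&` VW.2 = set0.
  move=> [Ky nUy].
  have ry : r t y = y by exact: retraction_fix (rskel_retraction skel t) Ky.
  have [c Cc cxy] : exists2 c, C c & r c x <> r c y.
    apply: contrapT => nc; apply: nUy => /=; rewrite -ry -(sep x y)// => c Cc.
    by apply: contrapT => cxy; apply: nc; exists c.
  have := hX; rewrite open_hausdorff => /(_ _ _ (introN eqP cxy)).
  move=> [VW /= [/set_mem V /set_mem W] [oV oW /eqP VW0]].
  by exists VW, c; split => //.
have [vw vwP] : {vw : X -> set X * set X * G & forall y, K y ->
    [/\ C (vw y).2, open (vw y).1.1, open (vw y).1.2,
      (vw y).1.1 (r (vw y).2 x) & (vw y).1.2 (r (vw y).2 y)] /\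
    (vw y).1.1 `&` (vw y).1.2 = set0}.
  apply: (@choice _ _ (fun y v => K y -> [/\ C v.2, open v.1.1, open v.1.2,
     v.1.1 (r v.2 x) & v.1.2 (r v.2 y)] /\ v.1.1 `&` v.1.2 = set0)) => y.
  have [/sepC[VW [c H]]|nK] := pselect (K y); first by exists (VW, c).
  by exists (set0, set0, c0) => /nK.
have cont s : continuous (r s) by have [] := rskel_retraction skel s.
have /compact_coverE /(_ X K (fun y => r (vw y).2 @^-1` (vw y).1.2)) := cK.
case=> [y Ky|y Ky|D DK cov].
- have [[_ _ oW _ _] _] := vwP y Ky.
  by apply: open_comp oW => ? _; exact: cont.
- by exists y => //; have [[]] := vwP y Ky.
have DK' y : y \in D -> K y by move=> /DK/set_mem.
have listC (l : seq X) : (forall y, y \in l -> C (vw y).2) ->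
    exists2 c, C c & forall y, y \in l -> ((vw y).2 <= c)%O.
  elim: l => [_|y l IH Cl]; first by exists c0 => // y; rewrite in_nil.
  have [|c Cc cl] := IH; first by move=> z zl; apply: Cl; rewrite inE zl orbT.
  have [|c' [Cc' cc' yc']] := dirC c (vw y).2 Cc.
    by apply: Cl; rewrite mem_head.
  by exists c' => // z; rewrite inE => /predU1P[->//|/cl zc]; exact: le_trans zc cc'.
have [c Cc cD] : exists2 c, C c & forall y, y \in D -> ((vw y).2 <= c)%O.
  by apply: listC => y yD; have [[]] := vwP y (DK' y yD).
pose O := \bigcap_(y in [set` D]) (r (vw y).2 @^-1` (vw y).1.1).
have oO : open O.
  rewrite openE => z Oz; apply: filter_bigI => y yD.
  have [[_ oV _ _ _] _] := vwP y (DK' y yD).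
  apply: open_nbhs_nbhs; split; last exact: Oz.
  by apply: open_comp oV => ? _; exact: cont.
have Oc z : O (r c z) <-> O z.
  by split => Oz y yD; have := Oz y yD; rewrite /= (skel_le_l _ (cD _ yD)).
have Ox : O x.
  by move=> y yD; have [[]] := vwP y (DK' y yD).
have [||b [Bb bx bO]] := baseB c O (r c x) oO; [exact/Oc|by exists x|].
exists (r c @^-1` b); split => //; first by exists c => //; exists b.
move=> z bz; rewrite /preimage /=; apply: contrapT => nU.
have Kz : K (r t z) by split => //; exists z.
have Oz : O z by apply/Oc/bO; split => //; exists z.
have [y yD Wz] := cov _ Kz.
have [[Cv _ _ _ _] VW0] := vwP y (DK' y yD).
have : ((vw y).1.1 `&` (vw y).1.2) (r (vw y).2 z).
  split; first exact: Oz.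
  by move: Wz; rewrite /= (skel_le_l _ (ub _ Cv)).
by rewrite VW0.
Qed.

End skeleton.

Lemma full_skeleton_monotonically_retractable (R : realType)
    (X : topologicalType) :
  hausdorff_space X ->
  has_full_retractional_skeleton R X -> monotonically_retractable X.
Proof.
move=> hX [d [G [r [skel full]]]].
have [[s0 _] dirG] := rskel_directed skel.
have [e eP] : {e : X -> G & forall x, range (r (e x)) x}.
  apply: (@choice _ _ (fun x s => range (r s) x)) => x.
  have : induced_set r x by rewrite full.
  by move=> [s _ sx]; exists s.
have [op opP] :
    {op : G * G -> G & forall p, (p.1 <= op p)%O /\ (p.2 <= op p)%O}.
  apply: (@choice _ _ (fun p u => (p.1 <= u)%O /\ (p.2 <= u)%O)) => p.
  exact: dirG.
have [B BP] : {B : G -> set (set X) & forall s, countable (B s) /\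
    forall O x, open O -> O x -> range (r s) x ->
    exists b, [/\ B s b, b x & b `&` range (r s) `<=` O]}.
  apply: (@choice _ _ (fun s B => countable B /\ forall O x, open O -> O x ->
    range (r s) x -> exists b, [/\ B b, b x & b `&` range (r s) `<=` O])) => s.
  have [B cB BP] := metrizable_countable_base
    (@rskel_compact _ _ _ _ _ skel s) (rskel_metrizable skel s).
  by exists B.
(* The index s0 provides an element of C A when A is empty. *)
pose base A := [set s0] `|` e @` A.
pose C A := op_hull (fun a b => op (a, b)) (base A).
have C0 A : C A s0 by apply: sub_op_hull; left.
have Ce A x : A x -> C A (e x).
  by move=> Ax; apply: sub_op_hull; right; exists x.
have dirC A a b : C A a -> C A b -> exists c, [/\ C A c, a <= c & b <= c]%O.
  move=> Ca Cb; exists (op (a, b)); have [ale ble] := opP (a, b); split => //.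
  exact: op_hull_op.
have cC A : countable A -> countable (C A).
  move=> cA; apply: countable_op_hull; apply: countable_setU => //.
  exact: sub_countable (card_image_le _ _) cA.
have [t tP] :
    {t : set X -> G & forall A, countable A -> determining_bound r (C A) (t A)}.
  apply: (@choice _ _ (fun A t =>
    countable A -> determining_bound r (C A) t)) => A.
  have [cA|nA] := pselect (countable A); last by exists s0 => /nA.
  have [t tP] := determining_boundP hX skel (cC A cA) (C0 A) (@dirC A).
  by exists t.
have baseS A A' : A `<=` A' -> base A `<=` base A'.
  by move=> AA; apply: setUS; apply: image_subset.
exists (fun A => r (t A)), (fun A => skeleton_network r B (C A)); split.
  move=> A cA; split.
  - exact: rskel_retraction skel _.
  - apply: bigcup_countable; first exact: cC.
    by move=> s _; apply: sub_countable (card_image_le _ _) _; have [] := BP s.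
  - move=> x Ax; apply: (skeleton_range_le skel _ (eP x)).
    by have [ub _] := tP A cA; apply/ub/Ce.
  - apply: (skeleton_networkP hX skel (C0 A) (@dirC A) _ (tP A cA)).
    by move=> s; have [_] := BP s.
split=> [A A' _ _ AA'|A cA Ai].
  by apply: bigcup_subset; apply: op_hullS; exact: baseS.
have Cbig : C (\bigcup_n A n) = \bigcup_n C (A n).
  rewrite /C -op_hull_bigcup => [|n]; last exact: baseS.
  congr op_hull; rewrite /base image_bigcup; apply/seteqP; split => x.
    by case=> [->|[n _ Ax]]; [exists 0%N => //; left|exists n => //; right].
  by move=> [n _ [->|Ax]]; [left|right; exists n].
by rewrite /skeleton_network Cbig bigcup_bigcup.
Qed.

Theorem theorem1p1 (R : realType) (X : topologicalType)
  (tychonoffX : tychonoff_space X) (ccX : countably_compact [set: X]) :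
  monotonically_retractable X <-> has_full_retractional_skeleton R X.
Proof.
split; first exact: monotonically_retractable_full_skeleton.
exact: full_skeleton_monotonically_retractable tychonoffX.2.
Qed.
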